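(* Let $n\ge1$. There is a constant $C>0$ (independent of $q$ and of the functions) such that for every odd prime power $q$ and all nonnegative $f_1,\dots,f_{2n}:\mathbb{F}_q^{2n}\to\mathbb{R}$, \[ \frac{1}{q^{2n+1}}\sum_{(x,t)\in\mathbb{F}_q^{2n}\times\mathbb{F}_q}\ \prod_{j=1}^{2n} f_j(\pi_j(x,t))\le C\prod_{j=1}^{2n}\|f_j\|_{L^{\frac{n(2n+1)}{n+1}}(\mathbb{F}_q^{2n},dx)}. \]
   Context: The Heisenberg group $\mathbb{H}^n(\mathbb{F}_q)$ is $\mathbb{F}_q^{2n+1}=\{(x,t):x\in\mathbb{F}_q^{2n},t\in\mathbb{F}_q\}$ with product $(x,t)\cdot(x',t')=\big(x+x',\,t+t'+\tfrac12\sum_{j=1}^n(x_jx'_{n+j}-x_{n+j}x'_j)\big)$. For $x\in\mathbb{F}_q^{2n}$ and $1\le j\le 2n$, $\widehat{x}_j\in\mathbb{F}_q^{2n-1}$ denotes $x$ with its $j$-th coordinate removed. The projections $\pi_j:\mathbb{H}^n(\mathbb{F}_q)\to\mathbb{F}_q^{2n}$ are, for $1\le j\le n$: $\pi_j(x,t)=(\widehat{x}_j,\,t+\tfrac12x_jx_{n+j})$ and $\pi_{n+j}(x,t)=(\widehat{x}_{n+j},\,t-\tfrac12x_jx_{n+j})$. Norms are normalized: $\|f\|_{L^r(\mathbb{F}_q^{2n},dx)}=\big(q^{-2n}\sum_{x\in\mathbb{F}_q^{2n}}|f(x)|^r\big)^{1/r}$. *)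

(* Defs.v *)
From HB Require Import structures.
From mathcomp Require Import all_boot all_order all_algebra.
From mathcomp Require Import all_classical all_reals exp.
From mathcomp Require Import ring.

Set Implicit Arguments.
Unset Strict Implicit.
Unset Printing Implicit Defensive.
Import Order.TTheory GRing.Theory Num.Theory.
Local Open Scope ring_scope.

(* Vectors of F^{2n} are row vectors of length n + n: for j : 'I_n, the
   coordinates x_j and x_{n+j} are x 0 (lshift n j) and x 0 (rshift n j). *)
Definition heis (F : finFieldType) (n : nat) : Type := ('rV[F]_(n + n) * F)%type.
HB.instance Definition _ (F : finFieldType) (n : nat) := Finite.on (heis F n).

Definition heis_mul (F : finFieldType) (n : nat) (p p' : heis F n) : heis F n :=
  (p.1 + p'.1,
   p.2 + p'.2 + 2^-1 * \sum_(j < n)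
     (p.1 0 (lshift n j) * p'.1 0 (rshift n j)
      - p.1 0 (rshift n j) * p'.1 0 (lshift n j))).

Lemma ord_pred_addn1 (d : nat) (j : 'I_d) : (d.-1 + 1 = d)%N.
Proof. by rewrite addn1 prednK // (leq_ltn_trans (leq0n j)). Qed.

(* The vector (\hat x_j, s) of F^d, for x in F^d and s in F. The index j
   witnesses that d is positive, which makes the cast possible. *)
Definition hat_rcons (F : finFieldType) (d : nat) (j : 'I_d)
    (x : 'rV[F]_d) (s : F) : 'rV[F]_d :=
  castmx (erefl 1%N, ord_pred_addn1 j) (row_mx (col' j x) (s%:M : 'rV[F]_1)).

Definition heis_proj (F : finFieldType) (n : nat) (j : 'I_(n + n))
    (p : heis F n) : 'rV[F]_(n + n) :=
  let: (x, t) := p in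
  hat_rcons j x
    match fintype.split j with
    | inl k => t + 2^-1 * (x 0 (lshift n k) * x 0 (rshift n k))
    | inr k => t - 2^-1 * (x 0 (lshift n k) * x 0 (rshift n k))
    end.

(* pi_j is constant on the left cosets of the j-th horizontal axis. *)
Lemma heis_proj_mul_axis (F : finFieldType) (n : nat) (j : 'I_(n + n))
    (p : heis F n) (s : F) :
  heis_proj j (heis_mul p (s *: delta_mx 0 j, 0)) = heis_proj j p.
Proof.
case: p => x t; rewrite /heis_proj /heis_mul /=.
have hatE u v : u = v -> hat_rcons j (x + s *: delta_mx 0 j) u = hat_rcons j x v.
  move=> ->; congr (castmx _ (row_mx _ _)); apply/rowP => i.
  by rewrite !mxE (eq_sym (lift j i)) (negbTE (neq_lift j i)) andbF mulr0 addr0.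
apply: hatE; rewrite addr0; case: (fintype.splitP j) => k jk.
  have -> : j = lshift n k by apply: val_inj.
  rewrite (bigD1 k) //= big1 => [|i ik]; rewrite !mxE ?eqxx !(eq_lshift, eq_rlshift) ?eqxx ?(negbTE ik) /=.
    by ring.
  by ring.
have -> : j = rshift n k by apply: val_inj.
rewrite (bigD1 k) //= big1 => [|i ik]; rewrite !mxE ?eqxx !(eq_rshift, eq_lrshift) ?eqxx ?(negbTE ik) /=.
  by ring.
by ring.
Qed.

Definition avg_Lnorm (R : realType) (F : finFieldType) (d : nat) (r : R)
    (f : 'rV[F]_d -> R) : R :=
  ((#|F|%:R ^+ d)^-1 * \sum_(x : 'rV[F]_d) `|f x| `^ r) `^ r^-1.

(* Main.v *)
Require Import Defs.
From HB Require Import structures.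
From mathcomp Require Import all_boot all_order all_algebra.
From mathcomp Require Import all_classical all_reals exp.
From mathcomp Require Import sequences ring lra.

Set Implicit Arguments.
Unset Strict Implicit.
Unset Printing Implicit Defensive.
Import Order.TTheory GRing.Theory Num.Theory.
Local Open Scope ring_scope.

(* Let N = 2n+1 and g_j = f_j^p with p = nN/(n+1), so that the right-hand side is
   a product of powers of the means of the g_j. Fix a pair of conjugate
   coordinates k, n+k, and give weight 2/N to j = k, n+k and 1/N to the other j.
   With all coordinates but k and n+k frozen, the mean over (x_k, x_{n+k}, t) of
   prod_j (g_j o pi_j)^{w_j} is bounded, by Hoelder, in terms of the means of the
   g_j o pi_j with j <> k, n+k, and of the mean of ((g_k o pi_k)(g_{n+k} o pi_{n+k}))^{2/3};
   the latter is the case n = 1, which is dual to the L^{3/2} -> L^3 bound for the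
   Radon transform of F_q^2. The means in (x_k, x_{n+k}, t) no longer see the shear
   in t, so the j-th one is independent of x_j, and since the weights w_j with
   j <> i sum to 1, a Loomis-Whitney argument averages out the frozen
   coordinates x_i one after the other. Finally prod_j f_j o pi_j is the geometric
   mean over k of these n products, because the average of w_j over k is 1/p, and
   Hoelder once more combines the n inequalities. *)

(** * Real powers, weighted AM-GM and Hoelder for finite sums *)

Lemma powR_prodl (R : realType) (I : finType) (P : pred I) (a : I -> R) (r : R) :
  (forall i, 0 <= a i) ->
  (\prod_(i | P i) a i) `^ r = \prod_(i | P i) a i `^ r.
Proof.
move=> a0; suff [] : 0 <= \prod_(i | P i) a i /\
  (\prod_(i | P i) a i) `^ r = \prod_(i | P i) a i `^ r by [].
elim/big_rec2: _ => [|i x y _ [x0 xE]]; first by rewrite powR1.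
by split; rewrite ?mulr_ge0// powRM// xE.
Qed.

Lemma powR_sumr (R : realType) (I : finType) (P : pred I) (c : R) (w : I -> R) :
  0 <= c -> (forall i, 0 < w i) -> \sum_(i | P i) w i != 0 ->
  c `^ (\sum_(i | P i) w i) = \prod_(i | P i) c `^ w i.
Proof.
rewrite le_eqVlt => /predU1P[<-|c0] w0 ws.
  have [i Pi|P0] := pickP P; last by rewrite big_pred0 ?eqxx in ws.
  by rewrite powR0// (bigD1 i)//= powR0 ?mul0r// gt_eqF.
elim/big_rec2: _ => [|i x y _ <-]; first by rewrite powRr0.
by rewrite powRD// (gt_eqF c0) implybT.
Qed.

(** Polya's argument: [1 + u <= expR u] at [u = a j / c - 1], with [c] the weighted mean, is raised
    to the power [w j] and multiplied over [j]; the exponents then add up to 0. If [c = 0], some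
    factor on the left vanishes. *)
Lemma weighted_AMGM (R : realType) (J : finType) (P : pred J) (w a : J -> R) :
  (forall j, 0 < w j) -> (forall j, 0 <= a j) -> \sum_(j | P j) w j = 1 ->
  \prod_(j | P j) a j `^ w j <= \sum_(j | P j) w j * a j.
Proof.
move=> w0 a0 w1; set c := \sum_(j | P j) w j * a j.
have wa0 j : 0 <= w j * a j by rewrite mulr_ge0// ltW.
have [c0|c0] := eqVneq c 0.
  have [j Pj|P0] := pickP P; last first.
    have : \sum_(j | P j) w j = 0 by rewrite big_pred0.
    by rewrite w1 => /eqP; rewrite oner_eq0.
  have /(_ j Pj)/eqP := psumr_eq0P (fun i (_ : P i) => wa0 i) c0.
  rewrite mulf_eq0 gt_eqF//= => /eqP aj0.
  rewrite c0 (bigD1 j)//= aj0 powR0 ?mul0r//.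
  by rewrite gt_eqF.
have {}c0 : 0 < c by rewrite lt_neqAle eq_sym c0 sumr_ge0.
have le j : a j `^ w j <= c `^ w j * expR (w j * (a j / c - 1)).
  have ac0 : 0 <= a j / c by rewrite divr_ge0// ltW.
  rewrite -[X in X `^ _ <= _](divfK (lt0r_neq0 c0)) mulrC powRM ?(ltW c0)//.
  rewrite ler_wpM2l ?powR_ge0// (mulrC (w j)) expRM ge0_ler_powR ?nnegrE ?expR_ge0 ?(ltW (w0 j))//.
  by have := expR_ge1Dx (a j / c - 1); rewrite addrC subrK.
apply: le_trans (_ : \prod_(j | P j) (c `^ w j * expR (w j * (a j / c - 1))) <= _).
  by apply: ler_prod => j _; rewrite powR_ge0 le.
rewrite big_split/= -powR_sumr ?w1 ?oner_neq0 ?powRr1 ?(ltW c0)// -expR_sum.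
rewrite (eq_bigr (fun j => (w j * a j) / c - w j)) => [|j _]; last by ring.
by rewrite sumrB w1 -mulr_suml -/c divff ?gt_eqF// subrr expR0 mulr1.
Qed.

(** Each [a j] is rescaled to total 1, after which AM-GM is applied at every [i] and summed. If some
    total vanishes, so does the left-hand side. *)
Lemma finite_holder (R : realType) (I J : finType) (P : pred J) (w : J -> R)
    (a : J -> I -> R) :
  (forall j, 0 < w j) -> (forall j i, 0 <= a j i) -> \sum_(j | P j) w j = 1 ->
  \sum_i \prod_(j | P j) a j i `^ w j <= \prod_(j | P j) (\sum_i a j i) `^ w j.
Proof.
move=> w0 a0 w1; have S0 j : 0 <= \sum_i a j i by rewrite sumr_ge0.
have [j /andP[Pj /eqP Sj0]|nz] := pickP (fun j => P j && (\sum_i a j i == 0)).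
  rewrite big1 ?prodr_ge0// => [j' _|i _]; first exact: powR_ge0.
  have aj0 : a j i = 0 by exact: (psumr_eq0P (fun i _ => a0 j i) Sj0).
  by rewrite (bigD1 j)//= aj0 powR0 ?gt_eqF ?mul0r.
pose b j i := a j i / \sum_i a j i.
have b0 j i : 0 <= b j i by rewrite divr_ge0.
have abE i : \prod_(j | P j) a j i `^ w j =
   (\prod_(j | P j) b j i `^ w j) * \prod_(j | P j) (\sum_i a j i) `^ w j.
  rewrite -big_split; apply: eq_bigr => j Pj /=.
  by rewrite -powRM// divfK//; move: (nz j); rewrite Pj => /negbT.
rewrite (eq_bigr _ (fun i _ => abE i)).
rewrite -mulr_suml ler_piMl ?prodr_ge0// => [j _|]; first exact: powR_ge0.
apply: le_trans (_ : \sum_i \sum_(j | P j) w j * b j i <= _).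
  by apply: ler_sum => i _; exact: weighted_AMGM.
rewrite exchange_big/= -w1 le_eqVlt; apply/orP; left; apply/eqP/eq_bigr => j Pj.
rewrite -mulr_sumr -mulr_suml divff ?mulr1//.
by move: (nz j); rewrite Pj => /negbT.
Qed.

(** Three equal weights, cubed so that only integer powers remain. *)
Lemma finite_holder3 (R : realType) (I : finType) (x y z : I -> R) :
  (forall i, 0 <= x i) -> (forall i, 0 <= y i) -> (forall i, 0 <= z i) ->
  (\sum_i x i * y i * z i) ^+ 3 <=
    (\sum_i x i ^+ 3) * (\sum_i y i ^+ 3) * (\sum_i z i ^+ 3).
Proof.
move=> x0 y0 z0.
pose a (j : 'I_3) i := [:: x i; y i; z i]`_j ^+ 3.
have a0 j i : 0 <= a j i by rewrite exprn_ge0//; case: j => [[|[|[]]]]/=.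
have cr (u : R) : 0 <= u -> (u ^+ 3) `^ 3^-1 = u.
  by move=> u0; rewrite -powR_mulrn// -powRrM divff ?pnatr_eq0// powRr1.
have rc (u : R) : 0 <= u -> (u `^ 3^-1) ^+ 3 = u.
  by move=> u0; rewrite -powR_mulrn ?powR_ge0// -powRrM mulVf ?pnatr_eq0// powRr1.
have e1 : \sum_(j < 3) 3^-1 = 1 :> R by rewrite !big_ord_recr big_ord0/=; lra.
have w0 (j : 'I_3) : 0 < 3^-1 :> R by rewrite invr_gt0.
have H := @finite_holder R I 'I_3 predT (fun=> 3^-1) a w0 a0 e1.
have {}H : \sum_i x i * y i * z i <= \prod_(j < 3) (\sum_i a j i) `^ 3^-1.
  apply: le_trans H.
  apply: ler_sum => i _; rewrite !big_ord_recr big_ord0/= mul1r.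
  by rewrite /a/= !cr.
have := lerXn2r 3 _ _ H; rewrite !nnegrE => {}H.
apply: le_trans (H _ _) _.
- by rewrite sumr_ge0// => i _; rewrite !mulr_ge0.
- by rewrite prodr_ge0// => j _; rewrite powR_ge0.
by rewrite !big_ord_recr big_ord0/= mul1r !exprMn !rc ?sumr_ge0.
Qed.

(** * The Radon transform of the plane over F *)

Lemma sum_pairE (V : nmodType) (I J : finType) (f : I * J -> V) :
  \sum_p f p = \sum_i \sum_j f (i, j).
Proof. by rewrite pair_bigA/=; apply: eq_bigr => -[]. Qed.

(* Separating the diagonal matters: summed over all lines, the diagonal of
   [(\sum b ^+ 3) ^+ 2] costs a factor [q], as [q] lines pass through each point,
   and cannot be afforded next to the factor [#|X|]. *)
Lemma line_cube (R : realType) (X : finType) (b : X -> R) :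
  (forall x, 0 <= b x) ->
  (\sum_x b x ^+ 2) ^+ 3 <= 2 * ((\sum_x b x ^+ 3) ^+ 2 +
     #|X|%:R * \sum_x \sum_(y | y != x) b x ^+ 3 * b y ^+ 3).
Proof.
move=> b0; set B := \sum_x b x ^+ 2; set D := \sum_x b x ^+ 3.
set Off := \sum_x _; set q : R := #|X|%:R.
have B0 : 0 <= B by rewrite sumr_ge0// => x _; rewrite exprn_ge0.
have D0 : 0 <= D by rewrite sumr_ge0// => x _; rewrite exprn_ge0.
have Off0 : 0 <= Off.
  by rewrite sumr_ge0// => x _; rewrite sumr_ge0// => y _; rewrite mulr_ge0 ?exprn_ge0.
have q0 : 0 <= q by rewrite ler0n.
have splitE k : (\sum_x b x ^+ k) ^+ 2 =
    \sum_x b x ^+ (k + k) + \sum_x \sum_(y | y != x) b x ^+ k * b y ^+ k.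
  rewrite expr2 mulr_suml -big_split/=; apply: eq_bigr => x _.
  by rewrite mulr_sumr (bigD1 x)//= exprD.
(* Diagonal and off-diagonal parts of [B ^+ 2]; each is bounded by its own use of Hoelder. *)
pose Q := \sum_x b x ^+ 4; pose O := \sum_x \sum_(y | y != x) b x ^+ 2 * b y ^+ 2.
have B2 : B ^+ 2 = Q + O by rewrite splitE.
have Q0 : 0 <= Q by rewrite sumr_ge0// => x _; rewrite exprn_ge0.
have O0 : 0 <= O.
  by rewrite sumr_ge0// => x _; rewrite sumr_ge0// => y _; rewrite mulr_ge0 ?exprn_ge0.
have Q3 : Q ^+ 3 <= (D ^+ 2) ^+ 2.
  have := @finite_holder3 R X b b (fun x => b x ^+ 2) b0 b0 (fun x => exprn_ge0 _ (b0 x)).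
  rewrite (eq_bigr (fun x => b x ^+ 4)) -/Q -/D => [|x _]; last by ring.
  rewrite (eq_bigr (fun x => b x ^+ (3 + 3))) => [|x _]; last by ring.
  move=> /le_trans; apply; rewrite [leRHS]expr2 [X in X * _ <= _](_ : _ = D ^+ 2)//.
  rewrite ler_wpM2l ?exprn_ge0// splitE lerDl//.
have O3 : O ^+ 3 <= (q * Off) ^+ 2.
  (* Extension by 0 to the diagonal; the constant third factor in Hoelder then contributes
     [q ^+ 2]. *)
  pose g (p : X * X) : R := if p.2 != p.1 then b p.1 * b p.2 else 0.
  have g0 p : 0 <= g p by rewrite /g; case: ifP => // _; rewrite mulr_ge0.
  have := @finite_holder3 R _ g g (fun=> 1) g0 g0 (fun=> ler01).
  have gE k : \sum_p g p ^+ k.+1 = \sum_x \sum_(y | y != x) b x ^+ k.+1 * b y ^+ k.+1.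
    rewrite pair_big_dep [RHS]big_mkcond/=; apply: eq_bigr => p _.
    by rewrite /g; case: ifP => _; rewrite ?exprMn// expr0n.
  rewrite (eq_bigr (fun x => g x ^+ 2)) => [|x _]; last by ring.
  rewrite !gE -/O -/Off => /le_trans; apply.
  rewrite (eq_bigr (fun=> 1)) => [|p _]; last by rewrite expr1n.
  by rewrite sumr_const card_prod natrM -/q le_eqVlt; apply/orP; left; apply/eqP; ring.
(* Squaring turns [B ^+ 3] into [(Q + O) ^+ 3], at most [4 * (Q ^+ 3 + O ^+ 3)] by convexity; the 4
   becomes the 2 of the statement. *)
have H : (B ^+ 3) ^+ 2 <= (2 * (D ^+ 2 + q * Off)) ^+ 2.
  have -> : (B ^+ 3) ^+ 2 = (Q + O) ^+ 3 by rewrite -B2; ring.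
  apply: le_trans (_ : 4 * (Q ^+ 3 + O ^+ 3) <= _).
    have : 0 <= (Q + O) * (Q - O) ^+ 2 by rewrite mulr_ge0 ?addr_ge0 ?sqr_ge0.
    by nra.
  have : 0 <= D ^+ 2 * (q * Off) by rewrite !mulr_ge0 ?exprn_ge0.
  nra.
have E0 : 0 <= 2 * (D ^+ 2 + q * Off) by rewrite mulr_ge0// addr_ge0 ?mulr_ge0 ?exprn_ge0.
by move: H; rewrite ler_pXn2r// nnegrE exprn_ge0.
Qed.

(* The [L^{3/2} -> L^3] bound for the finite Radon transform sending [beta ^ 2]
   to its sums over the lines [{(x, s - x y) | x}]. *)
Lemma radon_cube (R : realType) (F : finFieldType) (beta : F * F -> R) :
  (forall p, 0 <= beta p) ->
  \sum_(l : F * F) (\sum_x beta (x, l.2 - x * l.1) ^+ 2) ^+ 3 <=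
    6 * #|F|%:R * (\sum_p beta p ^+ 3) ^+ 2.
Proof.
move=> b0; set A := \sum_p beta p ^+ 3; set q : R := #|F|%:R.
have q1 : 1 <= q by rewrite ler1n; apply/card_gt0P; exists 0.
have A0 : 0 <= A by rewrite sumr_ge0// => p _; rewrite exprn_ge0.
pose Off (l : F * F) := \sum_x \sum_(x' | x' != x)
  beta (x, l.2 - x * l.1) ^+ 3 * beta (x', l.2 - x' * l.1) ^+ 3.
pose D (l : F * F) := \sum_x beta (x, l.2 - x * l.1) ^+ 3.
(* Two points with distinct abscissae lie on only one line, so each pair of points is counted at
   most once. *)
have OffA : \sum_l Off l <= A ^+ 2.
  rewrite /Off exchange_big/=; under eq_bigr do rewrite exchange_big/=.
  apply: le_trans (_ : \sum_x \sum_x' \sum_(u : F * F)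
     beta (x, u.1) ^+ 3 * beta (x', u.2) ^+ 3 <= _).
    apply: ler_sum => x _; rewrite [leRHS](bigID (fun x' => x' != x))/= -[leLHS]addr0.
    apply: lerD; last first.
      by do 2![apply: sumr_ge0 => ? _]; rewrite mulr_ge0 ?exprn_ge0.
    apply: ler_sum => x' x'x.
    rewrite [leRHS](reindex_inj (h := fun l : F * F => (l.2 - x * l.1, l.2 - x' * l.1)))//=.
    move=> [y s] [y' s'] /= [e1 e2].
    have : (x' - x) * (y - y') = 0.
      by transitivity ((s - x * y) - (s - x' * y) - ((s' - x * y') - (s' - x' * y')));
        [ring|rewrite e1 e2; ring].
    move=> /eqP; rewrite mulf_eq0 !subr_eq0 (negbTE x'x)/= => /eqP yy'.
    by move: e1; rewrite yy' => /addIr ->.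
  rewrite le_eqVlt; apply/orP; left; apply/eqP.
  have AE : A = \sum_x \sum_u beta (x, u) ^+ 3 := sum_pairE _.
  rewrite expr2 {1}AE mulr_suml; apply: eq_bigr => x _.
  rewrite AE mulr_sumr; apply: eq_bigr => x' _.
  rewrite mulr_suml [LHS]sum_pairE/=.
  by apply: eq_bigr => u _; rewrite mulr_sumr.
(* The diagonal contributes [q] times the sum of [beta p ^+ 6], as [q] lines pass through each
   point. *)
have DA : \sum_l D l ^+ 2 <= (1 + q) * A ^+ 2.
  have -> : \sum_l D l ^+ 2 = q * \sum_p beta p ^+ 6 + \sum_l Off l.
    have -> : q * \sum_p beta p ^+ 6 = \sum_(l : F * F) \sum_x beta (x, l.2 - x * l.1) ^+ 6.
      rewrite exchange_big/= sum_pairE mulr_sumr; apply: eq_bigr => x _.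
      rewrite [RHS]sum_pairE/= [RHS](eq_bigr (fun=> \sum_u beta (x, u) ^+ 6)) => [|y _].
        by rewrite sumr_const -mulr_natl.
      by rewrite [RHS](reindex_inj (addIr (- (x * y)))).
    rewrite -big_split; apply: eq_bigr => l _ /=.
    rewrite expr2 mulr_suml -big_split/=; apply: eq_bigr => x _.
    by rewrite mulr_sumr (bigD1 x)//= -exprD.
  rewrite mulrDl mul1r [leRHS]addrC lerD// ler_wpM2l ?(le_trans _ q1)//.
  rewrite expr2 mulr_suml; apply: ler_sum => p _.
  rewrite mulr_sumr (bigD1 p)//= -exprD lerDl.
  by apply: sumr_ge0 => p' _; rewrite mulr_ge0 ?exprn_ge0.
(* The total is at most [2 * (1 + 2 * q) * A ^+ 2], and [1 <= q] gives the constant 6. *)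
apply: le_trans (_ : \sum_l 2 * (D l ^+ 2 + q * Off l) <= _).
  by apply: ler_sum => l _; apply: line_cube.
rewrite -mulr_sumr big_split/= -mulr_sumr.
have A20 : 0 <= A ^+ 2 by rewrite exprn_ge0.
nra.
Qed.

(** * Normalized means and the case n = 1 *)

Definition mean (R : realType) (T : finType) (f : T -> R) : R :=
  #|T|%:R^-1 * \sum_x f x.

Lemma eq_mean (R : realType) (T : finType) (f g : T -> R) :
  f =1 g -> mean f = mean g.
Proof. by move=> fg; rewrite /mean (eq_bigr g). Qed.

Lemma mean_ge0 (R : realType) (T : finType) (f : T -> R) :
  (forall x, 0 <= f x) -> 0 <= mean f.
Proof. by move=> f0; rewrite mulr_ge0 ?invr_ge0 ?sumr_ge0. Qed.

Lemma ler_mean (R : realType) (T : finType) (f g : T -> R) :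
  (forall x, f x <= g x) -> mean f <= mean g.
Proof. by move=> fg; rewrite ler_wpM2l ?invr_ge0// ler_sum. Qed.

Lemma meanZ (R : realType) (T : finType) (c : R) (f : T -> R) :
  mean (fun x => c * f x) = c * mean f.
Proof. by rewrite /mean -mulr_sumr mulrCA. Qed.

Lemma mean_cst (R : realType) (T : finType) (c : R) :
  (0 < #|T|)%N -> mean (fun _ : T => c) = c.
Proof.
by move=> T0; rewrite /mean sumr_const -(mulr_natl c) mulKf// pnatr_eq0 -lt0n.
Qed.

Lemma mean_reindex (R : realType) (T : finType) (h : T -> T) (f : T -> R) :
  injective h -> mean (fun x => f (h x)) = mean f.
Proof. by move=> hI; rewrite /mean [in RHS](reindex_inj hI). Qed.

Lemma mean_pair (R : realType) (I J : finType) (f : I * J -> R) :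
  mean f = mean (fun i => mean (fun j => f (i, j))).
Proof.
rewrite /mean sum_pairE card_prod natrM invfM -mulrA mulr_sumr.
by congr (_ * _).
Qed.

Lemma mean_exchange (R : realType) (I J : finType) (f : I -> J -> R) :
  mean (fun i => mean (f i)) = mean (fun j => mean (f^~ j)).
Proof. by rewrite /mean -!mulr_sumr mulrCA exchange_big. Qed.

Lemma mean_holder (R : realType) (I J : finType) (P : pred J) (w : J -> R)
    (a : J -> I -> R) : (0 < #|I|)%N ->
  (forall j, 0 < w j) -> (forall j i, 0 <= a j i) -> \sum_(j | P j) w j = 1 ->
  mean (fun i => \prod_(j | P j) a j i `^ w j) <= \prod_(j | P j) mean (a j) `^ w j.
Proof.
move=> I0 w0 a0 w1; have c0 : 0 < #|I|%:R^-1 :> R by rewrite invr_gt0 ltr0n.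
have -> : \prod_(j | P j) mean (a j) `^ w j =
    #|I|%:R^-1 * \prod_(j | P j) (\sum_i a j i) `^ w j.
  have cE := @powR_sumr R J P _ w (ltW c0) w0.
  rewrite w1 oner_neq0 powRr1 ?(ltW c0)// in cE.
  rewrite {1}cE// -big_split/=.
  by apply: eq_bigr => j _; rewrite powRM ?sumr_ge0// ltW.
by rewrite ler_wpM2l ?(ltW c0)// finite_holder.
Qed.

(** Translating t by xy/2 leaves [alpha] at a point [l = (y, s)] and puts [beta] on the line with
    parameters [l]. Hoelder for [alpha * alpha * B] then reduces the claim to [radon_cube]. *)
Lemma heis1_cube (R : realType) (F : finFieldType) (alpha beta : F * F -> R) :
  (forall p, 0 <= alpha p) -> (forall p, 0 <= beta p) ->
  (2 : F) != 0 ->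
  (\sum_(u : F * F * F)
      alpha (u.1.2, u.2 + 2^-1 * (u.1.1 * u.1.2)) ^+ 2 *
      beta (u.1.1, u.2 - 2^-1 * (u.1.1 * u.1.2)) ^+ 2) ^+ 3 <=
    6 * #|F|%:R * (\sum_p alpha p ^+ 3) ^+ 2 * (\sum_p beta p ^+ 3) ^+ 2.
Proof.
move=> a0 b0 two0.
pose B (l : F * F) := \sum_x beta (x, l.2 - x * l.1) ^+ 2.
have B0 l : 0 <= B l by rewrite sumr_ge0// => x _; rewrite exprn_ge0.
have -> : \sum_(u : F * F * F)
      alpha (u.1.2, u.2 + 2^-1 * (u.1.1 * u.1.2)) ^+ 2 *
      beta (u.1.1, u.2 - 2^-1 * (u.1.1 * u.1.2)) ^+ 2 =
    \sum_l alpha l * alpha l * B l.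
  rewrite !sum_pairE exchange_big; apply: eq_bigr => y _.
  under [RHS]eq_bigr do rewrite /B mulr_sumr.
  rewrite [RHS]exchange_big; apply: eq_bigr => x _ /=.
  rewrite [RHS](reindex_inj (addIr (2^-1 * (x * y)))); apply: eq_bigr => t _ /=.
  rewrite -expr2; congr (_ * beta (_, _) ^+ 2).
  by field.
apply: le_trans (finite_holder3 a0 a0 B0) _.
by rewrite -expr2 mulrC [leRHS]mulrAC ler_wpM2r ?sqr_ge0// radon_cube.
Qed.

(** This is [heis1_cube] for the cube roots of [phi] and [psi]. After normalization both sides carry
    the same power of q, and the constant is 2 because [6 <= 2 ^ 3]. *)
Lemma mean_heis1 (R : realType) (F : finFieldType) (phi psi : F * F -> R) :
  (forall p, 0 <= phi p) -> (forall p, 0 <= psi p) ->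
  (2 : F) != 0 ->
  forall Phi Psi : F * F * F -> R,
  (forall u, Phi u = phi (u.1.2, u.2 + 2^-1 * (u.1.1 * u.1.2))) ->
  (forall u, Psi u = psi (u.1.1, u.2 - 2^-1 * (u.1.1 * u.1.2))) ->
  mean (fun u => (Phi u * Psi u) `^ (2 / 3)) <=
    2 * (mean Phi * mean Psi) `^ (2 / 3).
Proof.
move=> phi0 psi0 two0 Phi Psi PhiE PsiE.
have F0 : (0 < #|F|)%N by apply/card_gt0P; exists 0.
have meanPhi : mean Phi = mean phi.
  rewrite (eq_mean PhiE) mean_pair [LHS]mean_pair mean_exchange /= [RHS]mean_pair; apply: eq_mean => b.
  rewrite -[RHS](@mean_cst _ F)//; apply: eq_mean => a.
  exact: (mean_reindex (fun t => phi (b, t)) (addIr _)).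
have meanPsi : mean Psi = mean psi.
  rewrite (eq_mean PsiE) mean_pair [LHS]mean_pair /= [RHS]mean_pair; apply: eq_mean => a.
  rewrite -[RHS](@mean_cst _ F)//; apply: eq_mean => b.
  exact: (mean_reindex (fun t => psi (a, t)) (addIr _)).
pose cb (r : R) := r `^ 3^-1.
have cb0 r : 0 <= cb r by exact: powR_ge0.
have cbX r k : 0 <= r -> cb r ^+ k = r `^ (k%:R / 3).
  by move=> r0; rewrite -powR_mulrn// -powRrM mulrC.
have cb3 r : 0 <= r -> cb r ^+ 3 = r by move=> r0; rewrite cbX// divff ?pnatr_eq0// powRr1.
have := @heis1_cube R F (cb \o phi) (cb \o psi) (fun=> cb0 _) (fun=> cb0 _) two0.
rewrite /= (eq_bigr (fun u => (Phi u * Psi u) `^ (2 / 3))) => [|u _]; last first.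
  by rewrite PhiE PsiE !cbX// powRM.
have cb3E (f : F * F -> R) : (forall p, 0 <= f p) ->
  \sum_p cb (f p) ^+ 3 = \sum_p f p by move=> f0; apply: eq_bigr => p _; exact: cb3.
rewrite !cb3E//.
rewrite meanPhi meanPsi; set A := \sum_p phi p; set B := \sum_p psi p; set X := \sum_u _ => H.
have A0 : 0 <= A by rewrite sumr_ge0.
have B0 : 0 <= B by rewrite sumr_ge0.
have AB0 : 0 <= mean phi * mean psi by rewrite mulr_ge0// mean_ge0.
have r0 : 0 <= 2 * (mean phi * mean psi) `^ (2 / 3) by rewrite mulr_ge0 ?powR_ge0.
have l0 : 0 <= mean (fun u => (Phi u * Psi u) `^ (2 / 3)).
  by rewrite mean_ge0// => u; exact: powR_ge0.
rewrite -(@ler_pXn2r _ 3) ?nnegrE//.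
have P3 : ((mean phi * mean psi) `^ (2 / 3)) ^+ 3 = (mean phi * mean psi) ^+ 2.
  by rewrite -cbX// exprAC cb3.
rewrite [leRHS]exprMn P3 /mean -/A -/B -/X !card_prod !natrM.
set q : R := #|F|%:R in H *; have q0 : 0 < q by rewrite ltr0n.
have -> : ((q * q * q)^-1 * X) ^+ 3 = q ^- 9 * X ^+ 3 by field; rewrite gt_eqF.
have -> : 2 ^+ 3 * ((q * q)^-1 * A * ((q * q)^-1 * B)) ^+ 2 =
  q ^- 9 * (8 * q * A ^+ 2 * B ^+ 2) by field; rewrite gt_eqF.
rewrite ler_wpM2l ?invr_ge0 ?exprn_ge0 ?(ltW q0)// (le_trans H)//.
by rewrite -!mulrA ler_wpM2r ?mulr_ge0 ?sqr_ge0 ?ler_nat// ltW.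
Qed.

(** * Averaging one coordinate at a time: a Loomis-Whitney inequality *)

Definition upd (F : finFieldType) (d : nat) (x : 'rV[F]_d) (i : 'I_d) (s : F) :
  'rV[F]_d := \row_k (if k == i then s else x 0 k).

Lemma upd_upd (F : finFieldType) (d : nat) (x : 'rV[F]_d) i s s' :
  upd (upd x i s) i s' = upd x i s'.
Proof. by apply/rowP => k; rewrite !mxE; case: eqP. Qed.

Lemma updC (F : finFieldType) (d : nat) (x : 'rV[F]_d) i j s s' :
  i != j -> upd (upd x i s) j s' = upd (upd x j s') i s.
Proof.
move=> ij; apply/rowP => k; rewrite !mxE; have [->|//] := eqVneq k j.
by rewrite [j == i]eq_sym (negbTE ij).
Qed.

Lemma upd_id (F : finFieldType) (d : nat) (x : 'rV[F]_d) i : upd x i (x 0 i) = x.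
Proof. by apply/rowP => k; rewrite !mxE; case: eqP => [->|]. Qed.

Lemma card_finField_gt0 (F : finFieldType) : (0 < #|F|)%N.
Proof. by apply/card_gt0P; exists 0. Qed.

(** Exchanging [x 0 i] with [s] is an involution of the pairs [(x, s)]. *)
Lemma mean_upd (R : realType) (F : finFieldType) (d : nat) (i : 'I_d)
    (G : 'rV[F]_d -> R) :
  mean (fun x => mean (fun s => G (upd x i s))) = mean G.
Proof.
pose h (p : 'rV[F]_d * F) := (upd p.1 i p.2, p.1 0 i).
have hI : injective h.
  apply: (can_inj (g := h)) => -[x s].
  by rewrite /h /= upd_upd upd_id mxE eqxx.
transitivity (mean (fun p => G (h p).1)); first by rewrite [RHS]mean_pair.
rewrite (mean_reindex (fun p => G p.1) hI) mean_pair.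
by apply: eq_mean => x /=; rewrite mean_cst ?card_finField_gt0.
Qed.

Definition indep (R : realType) (F : finFieldType) (d : nat)
    (G : 'rV[F]_d -> R) (i : 'I_d) : Prop :=
  forall x s, G (upd x i s) = G x.

Lemma indep_all_cst (R : realType) (F : finFieldType) (d : nat)
    (G : 'rV[F]_d -> R) :
  (forall i, indep G i) -> forall x y, G x = G y.
Proof.
move=> Gi x y.
(* The coordinates of [x] are replaced by those of [y] from left to right. *)
suff H k : (k <= d)%N -> G (\row_(i < d) (if (i < k)%N then y 0 i else x 0 i)) = G x.
  rewrite -(H d)//; congr G; apply/rowP => i; by rewrite !mxE ltn_ord.
elim: k => [_|k IH kd]; first by congr G; apply/rowP => i; rewrite !mxE.
rewrite -(IH (ltnW kd)) -[RHS](Gi (Ordinal kd) _ (y 0 (Ordinal kd))).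
congr G; apply/rowP => i; rewrite !mxE ltnS leq_eqVlt -val_eqE/=.
by case: eqVneq => //= ik; have -> : i = Ordinal kd by apply: val_inj.
Qed.

Lemma indep_mean_upd (R : realType) (F : finFieldType) (d : nat)
    (G : 'rV[F]_d -> R) (i k : 'I_d) : (k != i -> indep G k) ->
  indep (fun x => mean (fun s => G (upd x i s))) k.
Proof.
move=> Gk x s; apply: eq_mean => s'.
have [->|ki] := eqVneq k i; first by rewrite upd_upd.
by rewrite updC// Gk.
Qed.

(** In the second alternative [G i] comes out of the average over x_i and Hoelder applies to the
    other factors, of total weight 1; the first covers coordinates that no factor sees. Averaging
    every [G j] over x_i keeps the means and preserves the alternatives for the coordinates still to
    be treated. *)
Lemma finner (R : realType) (F : finFieldType) (d : nat) (w : 'I_d -> R)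
    (G : 'I_d -> 'rV[F]_d -> R) :
  (forall j, 0 < w j) -> (forall j x, 0 <= G j x) ->
  (forall i, (forall j, indep (G j) i) \/
             (indep (G i) i /\ \sum_(j | j != i) w j = 1)) ->
  mean (fun x => \prod_j G j x `^ w j) <= \prod_j mean (G j) `^ w j.
Proof.
move=> w0 G0 Gw.
(* Invariant of the induction: no factor sees a coordinate outside the list. For the empty list all
   factors are constant. *)
have : forall i, i \notin enum 'I_d -> forall j, indep (G j) i.
  by move=> i; rewrite mem_enum.
have : forall i, i \in enum 'I_d -> (forall j, indep (G j) i) \/
   (indep (G i) i /\ \sum_(j | j != i) w j = 1) by move=> i _.
elim: (enum 'I_d) G G0 {Gw} => [|i s IH] G G0 Gs GNs.
  have V0 : (0 < #|{: 'rV[F]_d}|)%N by apply/card_gt0P; exists 0.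
  have GE j x : G j x = mean (G j).
    rewrite -[LHS](@mean_cst _ 'rV[F]_d)//; apply: eq_mean => y.
    by apply: indep_all_cst => i; exact: GNs.
  rewrite (eq_mean (g := fun=> \prod_j mean (G j) `^ w j)) ?mean_cst// => x.
  by apply: eq_bigr => j _; rewrite -(GE j x).
pose G' j x := mean (fun c => G j (upd x i c)).
apply: le_trans (_ : mean (fun x => \prod_j G' j x `^ w j) <= _); last first.
  have G'0 j x : 0 <= G' j x by rewrite mean_ge0.
  have -> : \prod_j mean (G j) `^ w j = \prod_j mean (G' j) `^ w j.
    by apply: eq_bigr => j _; rewrite mean_upd.
  apply: IH => // k ks.
    (* The list may repeat [i], which by now no factor sees. *)
    have [ki|ki] := eqVneq k i.
      by left=> j; apply: indep_mean_upd; rewrite ki eqxx.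
    case: (Gs k) => [|Gk|[Gk wk]]; first by rewrite inE ks orbT.
      by left=> j; apply: indep_mean_upd.
    by right; split => //; apply: indep_mean_upd.
  by move=> j; apply: indep_mean_upd => ki; apply: GNs; rewrite inE negb_or ki.
rewrite -(mean_upd i); apply: ler_mean => x.
case: (Gs i) => [|Gi|[Gi wi]]; first by rewrite inE eqxx.
  rewrite (eq_mean (g := fun=> \prod_j G' j x `^ w j)) ?mean_cst ?card_finField_gt0// => c.
  apply: eq_bigr => j _; rewrite Gi /G'.
  by rewrite (eq_mean (g := fun=> G j x)) ?mean_cst ?card_finField_gt0// => c'; exact: Gi.
rewrite (eq_mean (g := fun c => G i x `^ w i * \prod_(j | j != i) G j (upd x i c) `^ w j)); last first.
  by move=> c; rewrite (bigD1 i)//= Gi.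
rewrite meanZ (bigD1 i)//= /G' [in leRHS](eq_mean (g := fun=> G i x)) => [|c]; last exact: Gi.
rewrite mean_cst ?card_finField_gt0// ler_wpM2l ?powR_ge0//.
by apply: (mean_holder (a := fun j c => G j (upd x i c))) => //; exact: card_finField_gt0.
Qed.

(** * Means along the Heisenberg projections *)

Definition heis_shift (F : finFieldType) (n : nat) (j : 'I_(n + n))
    (x : 'rV[F]_(n + n)) : F :=
  match fintype.split j with
  | inl k => 2^-1 * (x 0 (lshift n k) * x 0 (rshift n k))
  | inr k => - (2^-1 * (x 0 (lshift n k) * x 0 (rshift n k)))
  end.

Lemma heis_projE (F : finFieldType) (n : nat) (j : 'I_(n + n))
    (x : 'rV[F]_(n + n)) (t : F) :
  heis_proj j ((x, t) : heis F n) = hat_rcons j x (t + heis_shift j x).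
Proof. by rewrite /heis_proj /heis_shift; case: fintype.split. Qed.

Lemma heis_shift_lshift (F : finFieldType) (n : nat) (k : 'I_n)
    (x : 'rV[F]_(n + n)) :
  heis_shift (lshift n k) x = 2^-1 * (x 0 (lshift n k) * x 0 (rshift n k)).
Proof. by rewrite /heis_shift (unsplitK (inl k)). Qed.

Lemma heis_shift_rshift (F : finFieldType) (n : nat) (k : 'I_n)
    (x : 'rV[F]_(n + n)) :
  heis_shift (rshift n k) x = - (2^-1 * (x 0 (lshift n k) * x 0 (rshift n k))).
Proof. by rewrite /heis_shift (unsplitK (inr k)). Qed.

Lemma hat_rcons_upd (F : finFieldType) (d : nat) (j : 'I_d) (x : 'rV[F]_d) c s :
  hat_rcons j (upd x j c) s = hat_rcons j x s.
Proof.
congr (castmx _ (row_mx _ _)); apply/rowP => i.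
by rewrite !mxE eq_sym (negbTE (neq_lift j i)).
Qed.

Lemma hat_rcons_inj (F : finFieldType) (d : nat) (j : 'I_d) (x x' : 'rV[F]_d) s s' :
  hat_rcons j x s = hat_rcons j x' s' -> x 0 j = x' 0 j -> x = x' /\ s = s'.
Proof.
move=> /(can_inj (castmxK _ _)) /eq_row_mx[xx' ss'] xj; split; last first.
  by move/rowP: ss' => /(_ 0); rewrite !mxE eqxx.
apply/rowP => k; case: (unliftP j k) => [i ->|->//].
by move/rowP: xx' => /(_ i); rewrite !mxE.
Qed.

(** Keeping the deleted [x 0 j] beside the image gives an injection of a finite set into itself,
    which preserves means. *)
Lemma mean_hat_rcons (R : realType) (F : finFieldType) (d : nat) (j : 'I_d)
    (g : 'rV[F]_d -> R) :
  mean (fun x => mean (fun t => g (hat_rcons j x t))) = mean g.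
Proof.
pose h (p : 'rV[F]_d * F) := (hat_rcons j p.1 p.2, p.1 0 j).
have hI : injective h.
  move=> [x s] [x' s'] [e1 e2]; by have [-> ->] := hat_rcons_inj e1 e2.
transitivity (mean (fun p => g (h p).1)); first by rewrite [RHS]mean_pair.
rewrite (mean_reindex (fun p => g p.1) hI) mean_pair.
by apply: eq_mean => x /=; rewrite mean_cst ?card_finField_gt0.
Qed.

(** A translation in t absorbs the shear, which was the only way x_j entered. *)
Lemma mean_heis_proj_fiber (R : realType) (F : finFieldType) (n : nat)
    (j : 'I_(n + n)) (g : 'rV[F]_(n + n) -> R) (x : 'rV[F]_(n + n)) :
  mean (fun t => g (heis_proj j ((x, t) : heis F n))) =
  mean (fun t => g (hat_rcons j x t)).
Proof.
under eq_mean do rewrite heis_projE.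
exact: (mean_reindex (fun t => g (hat_rcons j x t)) (addIr _)).
Qed.

Lemma mean_heis (R : realType) (F : finFieldType) (n : nat) (G : heis F n -> R) :
  mean G = mean (fun x => mean (fun t => G (x, t))).
Proof. exact: mean_pair. Qed.

Lemma mean_heis_proj (R : realType) (F : finFieldType) (n : nat) (j : 'I_(n + n))
    (g : 'rV[F]_(n + n) -> R) :
  mean (fun p : heis F n => g (heis_proj j p)) = mean g.
Proof.
rewrite mean_heis -[RHS](mean_hat_rcons j); apply: eq_mean => x.
exact: mean_heis_proj_fiber.
Qed.

(** Splits a mean over the group into means over three-variable slices. Each slice is met once for
    every value of the overwritten coordinates, which a mean does not notice. *)
Lemma mean_upd2 (R : realType) (F : finFieldType) (d : nat) (i i' : 'I_d)
    (G : 'rV[F]_d -> F -> R) :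
  mean (fun x => mean (fun u : F * F * F =>
    G (upd (upd x i' u.1.2) i u.1.1) u.2)) = mean (fun x => mean (G x)).
Proof.
rewrite -[RHS](mean_upd i) -[RHS](mean_upd i' (fun x => mean (fun s => mean (G (upd x i s))))).
by apply: eq_mean => x; rewrite mean_pair mean_pair mean_exchange.
Qed.

(** * The weights and the inequality of one conjugate pair *)

Definition pair_weight (R : realType) (n : nat) (k : 'I_n) (j : 'I_(n + n)) : R :=
  (2 * n + 1)%:R^-1 * (1 + (j == lshift n k)%:R + (j == rshift n k)%:R).

Lemma sum_eq_op (R : realType) (I : finType) (i : I) :
  \sum_j (j == i)%:R = 1 :> R.
Proof. by rewrite (bigD1 i)//= eqxx big1 ?addr0// => j /negbTE ->. Qed.

Section PairWeight.
Variables (R : realType) (n : nat) (k : 'I_n).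
Local Notation w := (pair_weight R k).
Local Notation N := ((2 * n + 1)%:R : R).

Lemma twonS_gt0 : 0 < N.
Proof. by rewrite ltr0n addn1. Qed.

Lemma pair_weight_gt0 j : 0 < w j.
Proof.
by rewrite mulr_gt0 ?invr_gt0 ?twonS_gt0// -addrA ltr_pwDl ?ltr01// addr_ge0 ?ler0n.
Qed.

Lemma pair_weight_lshift : w (lshift n k) = 2 / N.
Proof. by rewrite /pair_weight eqxx eq_lrshift addr0 mulrC. Qed.

Lemma pair_weight_rshift : w (rshift n k) = 2 / N.
Proof. by rewrite /pair_weight eqxx eq_rlshift addr0 mulrC. Qed.

Lemma pair_weight_off j : j != lshift n k -> j != rshift n k -> w j = N^-1.
Proof. by rewrite /pair_weight => /negbTE-> /negbTE->; rewrite !addr0 mulr1. Qed.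

Lemma sum_pair_weight : \sum_j w j = (2 * n + 2)%:R / N.
Proof.
rewrite -mulr_sumr !big_split/= !sum_eq_op sumr_const card_ord mulrC.
by congr (_ * _); rewrite !natr1 addnn mul2n addn2.
Qed.

(** All weights together give (N + 1)/N, so dropping one of weight 1/N leaves exactly the total that
    [finner] requires. *)
Lemma sum_pair_weight_off j : j != lshift n k -> j != rshift n k ->
  \sum_(i | i != j) w i = 1.
Proof.
move=> jl jr; have := sum_pair_weight.
rewrite (bigD1 j)//= (pair_weight_off jl jr) => /(canRL (addKr _)) ->.
have -> : (2 * n + 2)%:R = N + 1 by rewrite natr1 addn1 addn2.
by move: twonS_gt0; move: N => m m0; field; rewrite gt_eqF.
Qed.

(** Merges the two heavy factors into one of weight 3/N, in the form that [mean_heis1] bounds. *)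
Lemma prod_pair_weight (c : 'I_(n + n) -> R) : (forall j, 0 <= c j) ->
  \prod_j c j `^ w j =
    ((c (lshift n k) * c (rshift n k)) `^ (2 / 3)) `^ (3 / N) *
    \prod_(j | (j != rshift n k) && (j != lshift n k)) c j `^ N^-1.
Proof.
move=> c0; rewrite (bigD1 (rshift n k))//= (bigD1 (lshift n k)) ?eq_lrshift//=.
rewrite mulrA [X in X * _]mulrC pair_weight_lshift pair_weight_rshift -powRM//.
rewrite -powRrM mulrA divfK ?pnatr_eq0//; congr (_ * _).
by apply: eq_bigr => j /andP[jr jl]; rewrite pair_weight_off.
Qed.

End PairWeight.

Lemma slice_inequality (R : realType) (F : finFieldType) (n : nat) (k : 'I_n)
    (g : 'I_(n + n) -> 'rV[F]_(n + n) -> R) (x : 'rV[F]_(n + n)) :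
  (2 : F) != 0 -> (forall j y, 0 <= g j y) ->
  let G j (u : F * F * F) := g j (heis_proj j
    ((upd (upd x (rshift n k) u.1.2) (lshift n k) u.1.1, u.2) : heis F n)) in
  (mean (fun u => \prod_j G j u `^ pair_weight R k j) <=
    2 `^ (3 / (2 * n + 1)%:R) * \prod_j mean (G j) `^ pair_weight R k j)%R : Prop.
Proof.
move=> two0 g0 G; set N : R := (2 * n + 1)%:R.
have N0 : 0 < N by exact: twonS_gt0.
have G0 j u : 0 <= G j u by exact: g0.
pose P u := (G (lshift n k) u * G (rshift n k) u) `^ (2 / 3).
have P0 u : 0 <= P u by exact: powR_ge0.
(* Index [lshift n k] carries the merged pair and [rshift n k] is dropped; the weights are then 3/N
   once and 1/N for 2n - 2 indices, of sum 1. *)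
pose a j := if j == lshift n k then P else G j.
pose v (j : 'I_(n + n)) := if j == lshift n k then 3 / N else N^-1.
have v0 j : 0 < v j by rewrite /v; case: ifP => _; rewrite ?divr_gt0 ?invr_gt0.
have prod_av (b : 'I_(n + n) -> R) :
    \prod_(j | j != rshift n k) b j `^ v j =
    b (lshift n k) `^ (3 / N) *
    \prod_(j | (j != rshift n k) && (j != lshift n k)) b j `^ N^-1.
  rewrite (bigD1 (lshift n k)) ?eq_lrshift//= /v eqxx; congr (_ * _).
  by apply: eq_bigr => j /andP[_ /negbTE ->].
have v1 : \sum_(j | j != rshift n k) v j = 1.
  have H := sum_pair_weight R k.
  rewrite (bigD1 (rshift n k))//= (bigD1 (lshift n k)) ?eq_lrshift//= in H.
  rewrite pair_weight_lshift pair_weight_rshift -/N in H.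
  rewrite (bigD1 (lshift n k)) ?eq_lrshift//= {1}/v eqxx.
  rewrite (eq_bigr (pair_weight R k)) => [|j /andP[jr jl]]; last first.
    by rewrite pair_weight_off// /v (negbTE jl).
  have alg (m s : R) : 0 < m -> 2 / m + (2 / m + s) = (m + 1) / m -> 3 / m + s = 1.
    move=> m0 /(canRL (addKr _))/(canRL (addKr _)) ->.
    by field; rewrite gt_eqF.
  by apply: alg => //; rewrite H natr1 addn1 addn2.
rewrite (eq_mean (g := fun u => \prod_(j | j != rshift n k) a j u `^ v j)); last first.
  move=> u; rewrite prod_pair_weight// prod_av /a eqxx; congr (_ * _).
  by apply: eq_bigr => j /andP[_ /negbTE ->].
apply: le_trans (mean_holder _ v0 _ v1) _ => [|j u|].
- by apply/card_gt0P; exists (0, 0, 0).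
- by rewrite /a; case: ifP.
rewrite prod_av prod_pair_weight => [|j]; last exact: mean_ge0.
rewrite mulrA -powRM ?powR_ge0// /a eqxx.
rewrite [X in _ * X <= _](eq_bigr (fun j => mean (G j) `^ N^-1)) => [|j /andP[_ /negbTE ->]//].
rewrite ler_wpM2r ?prodr_ge0// => [j _|]; first exact: powR_ge0.
apply: ge0_ler_powR; rewrite ?nnegrE.
- by rewrite divr_ge0// ltW.
- exact: mean_ge0.
- by rewrite mulr_ge0// powR_ge0.
(* On the slice each projection of the pair forgets its own coordinate, so it sees only the
   conjugate one and the sheared t. *)
apply: (@mean_heis1 _ _ (fun p => g (lshift n k) (hat_rcons (lshift n k) (upd x (rshift n k) p.1) p.2))
   (fun p => g (rshift n k) (hat_rcons (rshift n k) (upd x (lshift n k) p.1) p.2))) => // u.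
  rewrite /G heis_projE hat_rcons_upd heis_shift_lshift !mxE eqxx.
  by rewrite eq_rlshift eqxx.
rewrite /G heis_projE heis_shift_rshift updC ?eq_rlshift// hat_rcons_upd !mxE eqxx.
by rewrite eq_lrshift eqxx.
Qed.

Lemma pair_inequality (R : realType) (F : finFieldType) (n : nat) (k : 'I_n)
    (g : 'I_(n + n) -> 'rV[F]_(n + n) -> R) :
  (2 : F) != 0 -> (forall j y, 0 <= g j y) ->
  mean (fun p : heis F n => \prod_j g j (heis_proj j p) `^ pair_weight R k j) <=
    2 `^ (3 / (2 * n + 1)%:R) * \prod_j mean (g j) `^ pair_weight R k j.
Proof.
move=> two0 g0; set l := lshift n k; set r := rshift n k.
pose G j (x : 'rV[F]_(n + n)) t := g j (heis_proj j ((x, t) : heis F n)).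
pose M j x := mean (fun u : F * F * F => G j (upd (upd x r u.1.2) l u.1.1) u.2).
have M0 j x : 0 <= M j x by apply: mean_ge0 => u; exact: g0.
have meanM j : mean (M j) = mean (g j).
  by rewrite /M mean_upd2 -[RHS](mean_heis_proj j) mean_heis.
rewrite mean_heis -(mean_upd2 l r (fun x t => \prod_j G j x t `^ pair_weight R k j)).
apply: le_trans (_ : mean (fun x => 2 `^ (3 / (2 * n + 1)%:R) *
    \prod_j M j x `^ pair_weight R k j) <= _).
  by apply: ler_mean => x; exact: slice_inequality.
rewrite meanZ ler_wpM2l ?powR_ge0//.
under [leRHS]eq_bigr do rewrite -meanM.
apply: finner => // [j|i]; first exact: pair_weight_gt0.
(* Coordinates [l] and [r] are overwritten in every slice, so no [M j] sees them. *)
have [->|il] := eqVneq i l.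
  left=> j x s; apply: eq_mean => u.
  by rewrite (updC _ s u.1.2) ?/l ?/r ?eq_lrshift// upd_upd.
have [->|ir] := eqVneq i r.
  by left=> j x s; apply: eq_mean => u; rewrite upd_upd.
(* For the other [i], the average over t inside [M i] has removed the shear, and with it x_i. *)
right; split; last exact: sum_pair_weight_off.
move=> x s; rewrite /M !mean_pair; apply: eq_mean => a; apply: eq_mean => b /=.
rewrite (updC _ s b)// (updC _ s a)// !mean_heis_proj_fiber.
by under eq_mean do rewrite hat_rcons_upd.
Qed.

(** * Geometric mean over the n conjugate pairs *)

Lemma sum_pair_weight_dual (R : realType) (n : nat) (j : 'I_(n + n)) :
  \sum_k pair_weight R k j = (n + 1)%:R / (2 * n + 1)%:R.
Proof.
rewrite -mulr_sumr !big_split/= sumr_const card_ord mulrC; congr (_ * _).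
rewrite natrD -addrA; congr (_ + _).
case: (split_ordP j) => i ->.
  rewrite [X in _ + X]big1 => [|k _]; last by rewrite eq_lrshift.
  rewrite addr0 -[RHS](sum_eq_op R i); apply: eq_bigr => k _.
  by rewrite eq_lshift eq_sym.
rewrite [X in X + _]big1 => [|k _]; last by rewrite eq_rlshift.
rewrite add0r -[RHS](sum_eq_op R i); apply: eq_bigr => k _.
by rewrite eq_rshift eq_sym.
Qed.

(** Translation by 1 permutes F, so summing over F gives [#|F|%:R = 0] in F; with 2 = 0 and [#|F|]
    odd this would read 1 = 0. *)
Lemma odd_card_two_neq0 (F : finFieldType) : odd #|F| -> (2 : F) != 0.
Proof.
move=> oF; apply/negP => /eqP two0.
have : \sum_(x : F) (x + 1) = \sum_(x : F) x by rewrite [RHS](reindex_inj (addIr 1)).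
rewrite big_split/= sumr_const => /(canRL (addKr _)); rewrite addNr.
rewrite -(odd_double_half #|F|) oF -mul2n mulrnDr mulrnA two0 mul0rn addr0.
by move/eqP; rewrite oner_eq0.
Qed.

Theorem theorem1p4 (R : realType) (n : nat) (hn : (1 <= n)%N) :
  exists C : R, 0 < C /\
    forall (F : finFieldType), odd #|F| ->
    forall f : 'I_(n + n) -> 'rV[F]_(n + n) -> R,
      (forall j y, 0 <= f j y) ->
      (#|F|%:R ^+ (2 * n + 1))^-1 *
        (\sum_(p : heis F n) \prod_(j < n + n) f j (heis_proj j p))
      <= C * \prod_(j < n + n)
               avg_Lnorm ((n * (2 * n + 1))%:R / (n + 1)%:R) (f j).
Proof.
(* The constant of [pair_inequality], the same for all k and hence unchanged by the geometric
   mean. *)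
pose C : R := 2 `^ (3 / (2 * n + 1)%:R).
have C0 : 0 < C by exact: powR_gt0.
exists C; split=> // F oF f f0.
have two0 := odd_card_two_neq0 oF.
set r : R := _ / _.
have n0 : n%:R != 0 :> R by rewrite pnatr_eq0 -lt0n.
have r0 : r != 0.
  by rewrite mulf_neq0 ?invr_eq0 ?pnatr_eq0 ?addn1// muln_eq0 negb_or -lt0n hn.
pose g j y := f j y `^ r.
have g0 j y : 0 <= g j y by exact: powR_ge0.
have powg (c : R) j : 0 <= c -> c `^ r^-1 = \prod_(k < n) (c `^ pair_weight R k j) `^ n%:R^-1.
  move=> c0.
  (* Each j lies in exactly one pair, so its weights over k add up to (n + 1)/N, which is n/r: this
     fixes the exponent. *)
  have rE : r^-1 = \sum_(k < n) pair_weight R k j * n%:R^-1.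
    rewrite -mulr_suml sum_pair_weight_dual /r natrM.
    by rewrite invf_div invfM mulrA mulrAC.
  rewrite rE powR_sumr -?rE ?invr_eq0// => [|k].
    by apply: eq_bigr => k _; rewrite powRrM.
  by rewrite mulr_gt0 ?pair_weight_gt0// invr_gt0 ltr0n.
have LnormE j : avg_Lnorm r (f j) = mean (g j) `^ r^-1.
  rewrite /avg_Lnorm /mean card_mx mul1n natrX; congr (_ `^ _); congr (_ * _).
  by apply: eq_bigr => y _; rewrite ger0_norm.
have -> : (#|F|%:R ^+ (2 * n + 1))^-1 *
    (\sum_(p : heis F n) \prod_(j < n + n) f j (heis_proj j p)) =
  mean (fun p : heis F n => \prod_(k < n)
    (\prod_j g j (heis_proj j p) `^ pair_weight R k j) `^ n%:R^-1).
  rewrite /mean; congr (_ * _).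
    have -> : #|{: heis F n}| = (#|F| ^ (2 * n + 1))%N.
      by rewrite card_prod card_mx mul1n addnn -mul2n addn1 expnSr.
    by rewrite natrX.
  apply: eq_bigr => p _.
  rewrite [RHS](eq_bigr (fun k => \prod_j
      (g j (heis_proj j p) `^ pair_weight R k j) `^ n%:R^-1)) => [|k _]; last first.
    by rewrite powR_prodl// => j; exact: powR_ge0.
  rewrite exchange_big/=; apply: eq_bigr => j _.
  by rewrite -powg// /g -powRrM divff// powRr1.
have V0 : (0 < #|{: heis F n}|)%N by apply/card_gt0P; exists (0, 0).
have wn0 : 0 < n%:R^-1 :> R by rewrite invr_gt0 ltr0n.
have wn1 : \sum_(k < n) n%:R^-1 = 1 :> R.
  by rewrite sumr_const card_ord -(mulr_natl n%:R^-1) divff.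
apply: le_trans (mean_holder V0 (fun=> wn0) _ wn1) _ => [k p|].
  by rewrite prodr_ge0// => j _; exact: powR_ge0.
apply: le_trans (_ : \prod_(k < n)
   (C * \prod_j mean (g j) `^ pair_weight R k j) `^ n%:R^-1 <= _).
  apply: ler_prod => k _; rewrite powR_ge0/=.
  have m0 : 0 <= mean (fun p : heis F n => \prod_j g j (heis_proj j p) `^ pair_weight R k j).
    by apply: mean_ge0 => p; rewrite prodr_ge0// => j _; exact: powR_ge0.
  have p0 : 0 <= \prod_j mean (g j) `^ pair_weight R k j.
    by rewrite prodr_ge0// => j _; exact: powR_ge0.
  apply: ge0_ler_powR; rewrite ?nnegrE.
  - exact: ltW.
  - exact: m0.
  - by rewrite mulr_ge0 ?(ltW C0).
  - exact: pair_inequality.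
(* What remains is an equality: the exponents of each [mean (g j)] recombine to 1/r by [powg]. *)
rewrite le_eqVlt; apply/orP; left; apply/eqP.
transitivity (\prod_(k < n) (C `^ n%:R^-1 *
   \prod_j (mean (g j) `^ pair_weight R k j) `^ n%:R^-1)).
  apply: eq_bigr => k _; rewrite powRM ?(ltW C0)//; last first.
    by rewrite prodr_ge0// => j _; exact: powR_ge0.
  by rewrite powR_prodl// => j; exact: powR_ge0.
rewrite big_split/= -powR_sumr ?wn1 ?oner_neq0 ?(ltW C0)// powRr1 ?(ltW C0)//.
congr (_ * _); rewrite exchange_big/=; apply: eq_bigr => j _.
by rewrite LnormE (powg _ j)// mean_ge0.
Qed.
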